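(* Let $\eta$ be a partial action of a Hausdorff topological group $G$ on a topological space $X$, let $H$ be a normal subgroup of $G$, and let $\eta_{G/H}$ be the partial action of $G/H$ on $X/\!\sim_H$ described in the context. Then: (i) for every $g\in G$, $(X/\!\sim_H)_{gH}=\{\pi_H(x)\mid x\in X \text{ and there is } h\in H \text{ such that } (hg^{-1},x)\in G*X\}$; (ii) the domain of $\eta_{G/H}$ is $$G/H*(X/\!\sim_H)=\{(gH,\pi_H(x))\mid (g,x)\in G\times X \text{ and there is } h\in H \text{ such that } (hg,x)\in G*X\};$$ (iii) for $(gH,\pi_H(x))\in G/H*(X/\!\sim_H)$ one has $\eta_{G/H}(gH,\pi_H(x))=\pi_H((hg)\cdot x)$, where $h\in H$ is such that $(hg,x)\in G*X$; (iv) the globalization of $\eta_{G/H}$ is $(G/H)$-equivalent to $X_G/\!\sim_H$, where $G/H$ acts on $X_G/\!\sim_H$ via $\mu_{G/H}$.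
   Context: A partial action of a topological group $G$ on a space $X$ is a function $\eta:G*X\to X$ with domain $G*X\subseteq G\times X$, written $g\cdot x=\eta(g,x)$, where ''$\exists g\cdot x$'' means $(g,x)\in G*X$, such that for all $g,h\in G$, $x\in X$: (PA1) if $\exists g\cdot x$ then $\exists g^{-1}\cdot(g\cdot x)$ and $g^{-1}\cdot(g\cdot x)=x$; (PA2) if $\exists g\cdot(h\cdot x)$ (in particular $\exists h\cdot x$) then $\exists (gh)\cdot x$ and $g\cdot(h\cdot x)=(gh)\cdot x$; (PA3) $\exists 1\cdot x$ and $1\cdot x=x$. Put $X_g=\{x\in X\mid \exists g^{-1}\cdot x\}$ and let $\eta_g:X_{g^{-1}}\to X_g$, $x\mapsto g\cdot x$, which is a bijection. All partial actions are assumed topological: every $X_g$ is open in $X$ and every $\eta_g$ is a homeomorphism. The enveloping space (globalization) of $\eta$ is $X_G=(G\times X)/R$ with the quotient topology, where $(g,x)R(h,y)$ iff $x\in X_{g^{-1}h}$ and $\eta_{h^{-1}g}(x)=y$; $[g,x]$ is the class of $(g,x)$. It carries the global action $\mu_g([h,x])=[gh,x]$ of $G$ (the enveloping action). The same definitions apply to partial actions of $G/H$ (with quotient topology). Orbit equivalence relation: $x\sim_G y$ iff there is $g\in G$ with $\exists g\cdot x$ and $g\cdot x=y$. For a subgroup $H$, $\{\eta_h\}_{h\in H}$ is a partial action of $H$ on $X$, with orbit relation $\sim_H$ and quotient map $\pi_H:X\to X/\!\sim_H$ (orbit spaces have the quotient topology). Likewise $H$ acts on $X_G$ by restricting $\mu$,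 and the orbit of $[g,x]$ in $X_G/\!\sim_H$ is written $H[g,x]$. Since $H$ is normal, $G/H$ acts globally on $X_G/\!\sim_H$ by $\mu_{G/H}$: $\mu_{gH}(H[t,x])=H[gt,x]$. The map $\varphi:X/\!\sim_H\to X_G/\!\sim_H$, $\pi_H(x)\mapsto H[1,x]$, is well defined and injective. The partial action $\eta_{G/H}$ of $G/H$ on $X/\!\sim_H$ is defined by $$(X/\!\sim_H)_{gH}=\varphi^{-1}\big(\mu_{gH}(\mathrm{Im}\,\varphi)\cap \mathrm{Im}\,\varphi\big),\qquad \eta_{gH}(z)=\varphi^{-1}(\mu_{gH}(\varphi(z)))\ \text{ for } z\in (X/\!\sim_H)_{g^{-1}H}.$$ Its domain $G/H*(X/\!\sim_H)$ is the set of pairs $(gH,z)$ with $z\in (X/\!\sim_H)_{g^{-1}H}$. If $K$ acts partially on spaces $A$ and $B$ (by $\alpha$, $\beta$), a function $\epsilon:A\to B$ is a $K$-map if $(k,a)\in K*A$ implies $(k,\epsilon(a))\in K*B$ and $\epsilon(\alpha(k,a))=\beta(k,\epsilon(a))$; $A$ and $B$ are $K$-equivalent if there is a $K$-map $A\to B$ that is a homeomorphism. *)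

(* Defs.v *)
From HB Require Import structures.
From mathcomp Require Import all_boot all_classical topology.

Set Implicit Arguments.
Unset Strict Implicit.
Unset Printing Implicit Defensive.

Local Open Scope classical_set_scope.
Local Open Scope group_scope.
Local Open Scope quotient_scope.

HB.mixin Record Group_isTopologicalGroup G of Group G & Topological G := {
  mulg_continuous : continuous (fun p : G * G => p.1 * p.2);
  invg_continuous : continuous (fun g : G => g^-1)
}.

#[short(type="topologicalGroupType")]
HB.structure Definition TopologicalGroup :=
  {G of Group G & Topological G & Group_isTopologicalGroup G}.

HB.mixin Record isConjClosed (G : groupType) (S : {pred G}) := {
  gpredJ : forall x g : G, x \in S -> x ^ g \in S
}.

#[short(type="normalSubgroup")]
HB.structure Definition NormalSubgroup (G : groupType) :=
  {S of GroupClosed G S & isConjClosed G S}.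

Definition homeomorphism (S T : topologicalType) (f : S -> T) :=
  exists f' : T -> S,
    [/\ cancel f f', cancel f' f, continuous f & continuous f'].

Definition homeomorphism_between (T : topologicalType) (A B : set T)
    (f : T -> T) :=
  exists f' : T -> T,
    [/\ {homo f : x / A x >-> B x} /\ {homo f' : y / B y >-> A y},
        (forall x, A x -> f' (f x) = x), (forall y, B y -> f (f' y) = y),
        {within A, continuous f} & {within B, continuous f'}].

(** [pdom] is the domain [G*X]; [pact] is a total function of which only the
    values on [pdom] are meaningful. *)
Record partial_action (G : topologicalGroupType) (X : topologicalType) :=
  PartialAction {
  pdom : set (G * X);
  pact : G -> X -> X;
  pact_inv : forall g x, pdom (g, x) ->
    pdom (g^-1, pact g x) /\ pact g^-1 (pact g x) = x;
  pact_mul : forall g h x, pdom (h, x) -> pdom (g, pact h x) ->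
    pdom (g * h, x) /\ pact g (pact h x) = pact (g * h) x;
  pact_one : forall x, pdom (1, x) /\ pact 1 x = x;
  pdom_open : forall g, open [set x | pdom (g^-1, x)];
  pact_homeo : forall g, homeomorphism_between
    [set x | pdom ((g^-1)^-1, x)] [set x | pdom (g^-1, x)] (pact g)
}.

(** The set [X_g]. *)
Definition pset (G : topologicalGroupType) (X : topologicalType)
    (eta : partial_action G X) (g : G) : set X :=
  [set x | pdom eta (g^-1, x)].

Definition Kmap (K : topologicalGroupType) (A B : topologicalType)
    (alpha : partial_action K A) (beta : partial_action K B) (e : A -> B) :=
  forall k a, pdom alpha (k, a) ->
    pdom beta (k, e a) /\ e (pact alpha k a) = pact beta k (e a).

Definition Kequivalent (K : topologicalGroupType) (A B : topologicalType)
    (alpha : partial_action K A) (beta : partial_action K B) :=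
  exists e : A -> B, Kmap alpha beta e /\ homeomorphism e.

Section PartialActionTheory.
Variables (G : topologicalGroupType) (X : topologicalType).
Implicit Types (eta : partial_action G X) (g h : G) (x y : X).

Lemma pact_open eta g : open [set x | pdom eta (g, x)].
Proof. by rewrite -[g]invgK; exact: pdom_open. Qed.

Lemma pact_continuous_at eta g x : pdom eta (g, x) ->
  {for x, continuous (pact eta g)}.
Proof.
move=> gx; have [f' [_ _ _ + _]] := pact_homeo eta g.
rewrite invgK continuous_open_subspace; last exact: pact_open.
by apply; rewrite inE.
Qed.

End PartialActionTheory.

(** A global action by homeomorphisms is a partial action with full domain. *)
Section GlobalAction.
Variables (G : topologicalGroupType) (X : topologicalType) (a : G -> X -> X).
Hypothesis a1 : forall x, a 1 x = x.
Hypothesis aM : forall g h x, a g (a h x) = a (g * h) x.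
Hypothesis a_cont : forall g, continuous (a g).

Let aK g x : a g^-1 (a g x) = x.
Proof. by rewrite aM mulVg a1. Qed.

Fact global_inv (g : G) x :
  setT (g, x) -> setT (g^-1, a g x) /\ a g^-1 (a g x) = x.
Proof. by []. Qed.

Fact global_mul (g h : G) x : setT (h, x) -> setT (g, a h x) ->
  setT (g * h, x) /\ a g (a h x) = a (g * h) x.
Proof. by []. Qed.

Fact global_one x : setT (1 : G, x) /\ a 1 x = x.
Proof. by []. Qed.

Fact global_open (g : G) : open [set x : X | setT (g^-1, x)].
Proof. exact: openT. Qed.

Fact global_homeo (g : G) : homeomorphism_between
  [set x : X | setT ((g^-1)^-1, x)] [set x | setT (g^-1, x)] (a g).
Proof.
exists (a g^-1); split => //; last 2 first.
- exact: continuous_subspaceT.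
- exact: continuous_subspaceT.
by move=> y _; rewrite -{1}[g]invgK aK.
Qed.

Definition global_action : partial_action G X :=
  PartialAction global_inv global_mul global_one global_open global_homeo.

End GlobalAction.

Section Enveloping.
Variables (G : topologicalGroupType) (X : topologicalType).
Variable eta : partial_action G X.

Definition envel_rel : rel (G * X) := fun p q =>
  `[< pset eta (p.1^-1 * q.1) p.2 /\ pact eta (q.1^-1 * p.1) p.2 = q.2 >].

Lemma envel_relP g x h y :
  reflect (pdom eta (h^-1 * g, x) /\ pact eta (h^-1 * g) x = y)
          (envel_rel (g, x) (h, y)).
Proof.
rewrite /envel_rel /pset /= invgM invgK; exact: asboolP.
Qed.

Fact envel_equiv_class : equiv_class_of envel_rel.
Proof.
have sym p q : envel_rel p q -> envel_rel q p.
  case: p q => [g x] [h y] /envel_relP[gx <-]; apply/envel_relP.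
  by have := pact_inv gx; rewrite invgM invgK.
split.
- by move=> [g x]; apply/envel_relP; rewrite mulVg; exact: pact_one.
- by move=> p q; apply/idP/idP; exact: sym.
- move=> [h y] [g x] [k z] /envel_relP[gx <-] /envel_relP[hy <-].
  apply/envel_relP; have [] := pact_mul gx hy.
  by rewrite mulgA mulgK.
Qed.

Canonical envel_equiv := EquivRelPack envel_equiv_class.

Definition envel : Type := quotient_topology {eq_quot envel_equiv}.
HB.instance Definition _ := Topological.on envel.
HB.instance Definition _ := Quotient.on envel.

(** The class [[g, x]]. *)
Definition envel_class (g : G) (x : X) : envel := \pi_envel (g, x).

Lemma envel_classP g x h y :
  (envel_class g x = envel_class h y) <->
  (pdom eta (h^-1 * g, x) /\ pact eta (h^-1 * g) x = y).
Proof.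
by split=> [/eqquotP/envel_relP|?]; last exact/eqquotP/envel_relP.
Qed.

Lemma envel_ind (P : envel -> Prop) :
  (forall g x, P (envel_class g x)) -> forall u, P u.
Proof. by move=> Pc u; rewrite -[u]reprK; case: (repr u) => g x; exact: Pc. Qed.

Definition envel_mu (g : G) (u : envel) : envel :=
  envel_class (g * (repr u).1) (repr u).2.

Lemma envel_muE g h x : envel_mu g (envel_class h x) = envel_class (g * h) x.
Proof.
rewrite /envel_mu.
have : envel_class (repr (envel_class h x)).1 (repr (envel_class h x)).2
       = envel_class h x.
  by rewrite -[RHS]reprK /envel_class -surjective_pairing.
move/envel_classP => e; apply/envel_classP.
by rewrite invgM -mulgA mulKg.
Qed.

Fact envel_mu1 u : envel_mu 1 u = u.
Proof. by elim/envel_ind: u => h x; rewrite envel_muE mul1g. Qed.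

Fact envel_muM g h u : envel_mu g (envel_mu h u) = envel_mu (g * h) u.
Proof. by elim/envel_ind: u => k x; rewrite !envel_muE mulgA. Qed.

Fact envel_mu_continuous g : continuous (envel_mu g).
Proof.
apply/quotient_continuous.
have -> : envel_mu g \o \pi_envel =
    \pi_envel \o (fun p : G * X => (g * p.1, p.2)).
  by apply/funext => -[h x] /=; exact: envel_muE.
move=> p; apply: continuous_comp; last exact: pi_continuous.
apply: cvg_pair; last exact: cvg_snd.
apply: (@continuous_comp _ _ _ (fun p : G * X => (g, p.1))
  (fun q : G * G => q.1 * q.2)); last exact: mulg_continuous.
by apply: cvg_pair; [exact: cvg_cst|exact: cvg_fst].
Qed.

Definition envel_action : partial_action G envel :=
  global_action envel_mu1 envel_muM envel_mu_continuous.

End Enveloping.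

Section Orbits.
Variables (G : topologicalGroupType) (X : topologicalType).
Variables (eta : partial_action G X) (H : groupClosed G).

(** The orbit relation of the restriction of [eta] to [H]; applied to
    [envel_action eta] it is that of the restriction of [mu]. *)
Definition orbit_rel : rel X := fun x y =>
  `[< exists2 h, h \in H & pdom eta (h, x) /\ pact eta h x = y >].

Lemma orbit_relP x y :
  reflect (exists2 h, h \in H & pdom eta (h, x) /\ pact eta h x = y)
          (orbit_rel x y).
Proof. exact: asboolP. Qed.

Fact orbit_equiv_class : equiv_class_of orbit_rel.
Proof.
have sym x y : orbit_rel x y -> orbit_rel y x.
  move=> /orbit_relP[h Hh [hx <-]]; apply/orbit_relP.
  by exists h^-1; [rewrite gpredV|exact: pact_inv].
split.
- by move=> x; apply/orbit_relP; exists 1; [exact: gpred1|exact: pact_one].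
- by move=> x y; apply/idP/idP; exact: sym.
- move=> y x z /orbit_relP[h Hh [hx <-]] /orbit_relP[k Hk [ky <-]].
  apply/orbit_relP; exists (k * h); first exact: gpredM.
  by have [] := pact_mul hx ky.
Qed.

Canonical orbit_equiv := EquivRelPack orbit_equiv_class.

Definition orbit_space : Type := quotient_topology {eq_quot orbit_equiv}.
HB.instance Definition _ := Topological.on orbit_space.
HB.instance Definition _ := Quotient.on orbit_space.

(** The quotient map [pi_H]. *)
Definition orb (x : X) : orbit_space := \pi_orbit_space x.

Lemma orbP x y : (orb x = orb y) <->
  (exists2 h, h \in H & pdom eta (h, x) /\ pact eta h x = y).
Proof.
by split=> [/eqquotP/orbit_relP|?]; last exact/eqquotP/orbit_relP.
Qed.

Lemma orb_ind (P : orbit_space -> Prop) :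
  (forall x, P (orb x)) -> forall u, P u.
Proof. by move=> Px u; rewrite -[u]reprK; exact: Px. Qed.

Lemma orb_continuous : continuous orb.
Proof. exact: pi_continuous. Qed.

Lemma orb_open (U : set X) : open U -> open (orb @` U).
Proof.
move=> oU.
suff : open (orb @^-1` (orb @` U)) by [].
have -> : orb @^-1` (orb @` U) =
    \bigcup_(h in [set h | h \in H])
      ([set x | pdom eta (h, x)] `&` pact eta h @^-1` U).
  apply/seteqP; split=> [x [y Uy /esym/orbP[h Hh [hx e]]]|x [h Hh [hx Ux]]].
    by exists h => //; split=> //=; rewrite e.
  by exists (pact eta h x) => //; apply/esym/orbP; exists h.
apply: bigcup_open => h Hh; rewrite openE => x [hx Ux].
apply: filterI; first exact: open_nbhs_nbhs (conj (pact_open eta h) hx).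
by apply: (pact_continuous_at hx); exact: open_nbhs_nbhs.
Qed.

Lemma orb_nbhs x (U : set X) : nbhs x U -> nbhs (orb x) (orb @` U).
Proof.
rewrite nbhsE => -[V [oV Vx] VU].
apply: (@filterS _ _ _ (orb @` V)); first exact: image_subset.
by apply: open_nbhs_nbhs; split; [exact: orb_open|exists x].
Qed.

End Orbits.

Section QuotientGroup.
Variables (G : topologicalGroupType) (H : normalSubgroup G).
Implicit Types g h k : G.

Definition coset_rel : rel G := fun g k => g^-1 * k \in H.

Fact coset_equiv_class : equiv_class_of coset_rel.
Proof.
split.
- by move=> g; rewrite /coset_rel mulVg gpred1.
- by move=> g k; rewrite /coset_rel -[RHS]gpredV invgM invgK.
- move=> k g l gk kl; rewrite /coset_rel.
  by have := gpredM _ _ gk kl; rewrite mulgA mulgK.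
Qed.

Canonical coset_equiv := EquivRelPack coset_equiv_class.

Definition quotg : Type := quotient_topology {eq_quot coset_equiv}.
HB.instance Definition _ := Topological.on quotg.
HB.instance Definition _ := Quotient.on quotg.

(** The coset [gH]. *)
Definition cosetq (g : G) : quotg := \pi_quotg g.

Lemma cosetqP g k : (cosetq g = cosetq k) <-> (g^-1 * k \in H).
Proof. by split=> [/eqquotP|e]; last exact/eqquotP. Qed.

Lemma cosetq_ind (P : quotg -> Prop) :
  (forall g, P (cosetq g)) -> forall c, P c.
Proof. by move=> Pg c; rewrite -[c]reprK; exact: Pg. Qed.

Definition quotg_mul (c d : quotg) : quotg := cosetq (repr c * repr d).
Definition quotg_inv (c : quotg) : quotg := cosetq (repr c)^-1.
Definition quotg_one : quotg := cosetq 1.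

Lemma repr_cosetq g : exists2 h, h \in H & repr (cosetq g) = g * h.
Proof.
have /esym/cosetqP e : cosetq (repr (cosetq g)) = cosetq g := reprK _.
by exists (g^-1 * repr (cosetq g)) => //; rewrite mulVKg.
Qed.

Lemma quotg_mulE g k : quotg_mul (cosetq g) (cosetq k) = cosetq (g * k).
Proof.
rewrite /quotg_mul; have [h Hh ->] := repr_cosetq g.
have [l Hl ->] := repr_cosetq k; apply/esym/cosetqP.
have -> : (g * k)^-1 * (g * h * (k * l)) = h ^ k * l.
  by rewrite invgM /conjg !mulgA mulgVK.
by apply: gpredM => //; exact: gpredJ.
Qed.

Lemma quotg_invE g : quotg_inv (cosetq g) = cosetq g^-1.
Proof.
rewrite /quotg_inv; have [h Hh ->] := repr_cosetq g; apply/cosetqP.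
rewrite invgK.
have -> : g * h * g^-1 = h ^ g^-1 by rewrite /conjg invgK mulgA.
exact: gpredJ.
Qed.

Fact quotg_mulA : associative quotg_mul.
Proof.
elim/cosetq_ind=> a; elim/cosetq_ind=> b; elim/cosetq_ind=> c.
by rewrite !quotg_mulE mulgA.
Qed.

Fact quotg_mul1 : left_id quotg_one quotg_mul.
Proof. by elim/cosetq_ind=> a; rewrite quotg_mulE mul1g. Qed.

Fact quotg_mulr1 : right_id quotg_one quotg_mul.
Proof. by elim/cosetq_ind=> a; rewrite quotg_mulE mulg1. Qed.

Fact quotg_mulV : left_inverse quotg_one quotg_inv quotg_mul.
Proof. by elim/cosetq_ind=> a; rewrite quotg_invE quotg_mulE mulVg. Qed.

Fact quotg_mulrV : right_inverse quotg_one quotg_inv quotg_mul.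
Proof. by elim/cosetq_ind=> a; rewrite quotg_invE quotg_mulE mulgV. Qed.

HB.instance Definition _ := isGroup.Build quotg
  quotg_mulA quotg_mul1 quotg_mulr1 quotg_mulV quotg_mulrV.

Lemma cosetqM g k : cosetq (g * k) = cosetq g * cosetq k.
Proof. exact/esym/quotg_mulE. Qed.

Lemma cosetqV g : cosetq g^-1 = (cosetq g)^-1.
Proof. exact/esym/quotg_invE. Qed.

Lemma cosetq_continuous : continuous cosetq.
Proof. exact: pi_continuous. Qed.

Lemma cosetq_open (U : set G) : open U -> open (cosetq @` U).
Proof.
move=> oU.
suff : open (cosetq @^-1` (cosetq @` U)) by [].
have -> : cosetq @^-1` (cosetq @` U) =
    \bigcup_(h in [set h | h \in H]) ((fun g => g * h) @^-1` U).
  apply/seteqP; split=> [g [k Uk /esym/cosetqP e]|g [h /= Hh Ugh]].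
    by exists (g^-1 * k) => //=; rewrite mulVKg.
  by exists (g * h) => //; apply/esym/cosetqP; rewrite mulKg.
apply: bigcup_open => h Hh; apply: open_comp => // g _.
apply: (@continuous_comp _ _ _ (fun g => (g, h))
  (fun q : G * G => q.1 * q.2)); last exact: mulg_continuous.
by apply: cvg_pair; [exact: cvg_id|exact: cvg_cst].
Qed.

Lemma cosetq_nbhs g (U : set G) : nbhs g U -> nbhs (cosetq g) (cosetq @` U).
Proof.
rewrite nbhsE => -[V [oV Vg] VU].
apply: (@filterS _ _ _ (cosetq @` V)); first exact: image_subset.
by apply: open_nbhs_nbhs; split; [exact: cosetq_open|exists g].
Qed.

Fact quotg_mul_continuous : continuous (fun p : quotg * quotg => p.1 * p.2).
Proof.
move=> [c d]; elim/cosetq_ind: c => g; elim/cosetq_ind: d => k W /=.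
rewrite -cosetqM => /cosetq_continuous.
move=> /(@mulg_continuous G (g, k)) [[A B] /= [nA nB] AB].
exists (cosetq @` A, cosetq @` B).
  by split; exact: cosetq_nbhs.
move=> [_ _] /= [[a Aa <-] [b Bb <-]]; rewrite -cosetqM.
exact: (AB (a, b)).
Qed.

Fact quotg_inv_continuous : continuous (fun c : quotg => c^-1).
Proof.
apply/quotient_continuous.
have -> : (fun c : quotg => c^-1) \o \pi_quotg = cosetq \o (fun g => g^-1).
  by apply/funext => g /=; exact/esym/cosetqV.
move=> g; apply: continuous_comp; first exact: invg_continuous.
exact: cosetq_continuous.
Qed.

HB.instance Definition _ := Group_isTopologicalGroup.Build quotg
  quotg_mul_continuous quotg_inv_continuous.

End QuotientGroup.

Section QuotientAction.
Variables (G : topologicalGroupType) (X : topologicalType).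
Variables (eta : partial_action G X) (H : normalSubgroup G).

Local Notation XH := (orbit_space eta H).
Local Notation XGH := (orbit_space (envel_action eta) H).

(** The orbit [H[g, x]]. *)
Definition orb_class (g : G) (x : X) : XGH :=
  orb (envel_action eta) H (envel_class eta g x).

Lemma orb_classP g x k y : (orb_class g x = orb_class k y) <->
  (exists2 h, h \in H &
     pdom eta (h * k^-1 * g, x) /\ pact eta (h * k^-1 * g) x = y).
Proof.
split.
- move=> /orbP[h Hh [_ /=]]; rewrite envel_muE => /envel_classP e.
  exists (h ^ k); first exact: gpredJ.
  by rewrite /conjg -!mulgA mulVKg.
- move=> [h Hh e]; apply/orbP; exists (h ^ k^-1); first exact: gpredJ.
  split=> //=; rewrite envel_muE; apply/envel_classP.
  by rewrite /conjg invgK !mulgA mulVg mul1g.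
Qed.

Lemma orb_class_ind (P : XGH -> Prop) :
  (forall g x, P (orb_class g x)) -> forall u, P u.
Proof.
move=> Pgx u; elim/orb_ind: u => v; elim/envel_ind: v => g x; exact: Pgx.
Qed.

Definition muGH (c : quotg H) (u : XGH) : XGH :=
  orb (envel_action eta) H (envel_mu (repr c) (repr u)).

Lemma muGHE g t x : muGH (cosetq H g) (orb_class t x) = orb_class (g * t) x.
Proof.
rewrite /muGH; have [h Hh ->] := repr_cosetq H g.
have : orb (envel_action eta) H (repr (orb_class t x)) = orb_class t x.
  exact: reprK.
elim/envel_ind: (repr _) => s y; rewrite envel_muE -!/(orb_class _ _).
move=> /orb_classP[k Hk e]; apply/orb_classP.
exists (k * (h^-1) ^ t).
  by apply: gpredM => //; apply: gpredJ; rewrite gpredV.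
suff -> : k * h^-1 ^ t * (g * t)^-1 * (g * h * s) = k * t^-1 * s by [].
by rewrite /conjg invgM -!mulgA mulVKg mulKg mulKg.
Qed.

Fact muGH1 u : muGH 1 u = u.
Proof. by elim/orb_class_ind: u => t x; rewrite muGHE mul1g. Qed.

Fact muGHM c d u : muGH c (muGH d u) = muGH (c * d) u.
Proof.
elim/cosetq_ind: c => g; elim/cosetq_ind: d => k.
by elim/orb_class_ind: u => t x; rewrite -cosetqM !muGHE mulgA.
Qed.

Fact muGH_continuous c : continuous (muGH c).
Proof.
elim/cosetq_ind: c => g; apply/quotient_continuous.
have -> : muGH (cosetq H g) \o \pi_XGH =
    orb (envel_action eta) H \o envel_mu g.
  apply/funext => v /=; elim/envel_ind: v => t x.
  by rewrite envel_muE; exact: muGHE.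
move=> v; apply: continuous_comp; first exact: envel_mu_continuous.
exact: orb_continuous.
Qed.

Definition muGH_action : partial_action (quotg H) XGH :=
  global_action muGH1 muGHM muGH_continuous.

Definition phi (z : XH) : XGH := orb_class 1 (repr z).

Lemma phiE x : phi (orb eta H x) = orb_class 1 x.
Proof.
have /orbP[h Hh e] : orb eta H (repr (orb eta H x)) = orb eta H x.
  exact: reprK.
by apply/orb_classP; exists h => //; rewrite invg1 !mulg1.
Qed.

Lemma phi_inj : injective phi.
Proof.
elim/orb_ind=> x; elim/orb_ind=> y; rewrite !phiE => /orb_classP[h Hh].
by rewrite invg1 !mulg1 => e; apply/orbP; exists h.
Qed.

(** The set [(X/~H)_c] for a coset [c]; see [pset_etaGH]. *)
Definition etaGH_set (c : quotg H) : set XH :=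
  phi @^-1` ((muGH c @` range phi) `&` range phi).

Definition etaGH_dom : set (quotg H * XH) :=
  [set p | etaGH_set p.1^-1 p.2].

(** The preimage of [muGH c (phi z)] under the injective map [phi] when it
    exists, in particular on [etaGH_set c^-1]; [z] is a dummy value. *)
Definition etaGH_act (c : quotg H) (z : XH) : XH :=
  xget z [set w | phi w = muGH c (phi z)].

Lemma etaGH_domP c z :
  etaGH_dom (c, z) <-> exists w, phi w = muGH c (phi z).
Proof.
split=> [[[_ [w _ <-] e] _]|[w e]].
  by exists w; rewrite -e muGHM mulgV muGH1.
split; last by exists z.
by exists (phi w); [exists w|rewrite e /= muGHM mulVg muGH1].
Qed.

Lemma etaGH_actP c z : etaGH_dom (c, z) ->
  phi (etaGH_act c z) = muGH c (phi z).
Proof.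
move=> /etaGH_domP[w e]; rewrite /etaGH_act.
exact: (@xgetPex _ z [set w | phi w = muGH c (phi z)]) (ex_intro _ w e).
Qed.

Lemma etaGH_eq c z w : phi w = muGH c (phi z) -> etaGH_act c z = w.
Proof.
by move=> e; apply: phi_inj; rewrite e etaGH_actP//; apply/etaGH_domP; exists w.
Qed.

Lemma muGH_phi g h x : h \in H -> pdom eta (h * g, x) ->
  phi (orb eta H (pact eta (h * g) x)) = muGH (cosetq H g) (phi (orb eta H x)).
Proof.
move=> Hh hgx; rewrite !phiE muGHE mulg1; apply/esym/orb_classP.
by exists h => //; rewrite invg1 mulg1.
Qed.

Lemma etaGH_domE g x : etaGH_dom (cosetq H g, orb eta H x) <->
  (exists2 h, h \in H & pdom eta (h * g, x)).
Proof.
split=> [/etaGH_domP[w]|[h Hh hgx]].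
  elim/orb_ind: w => y; rewrite !phiE muGHE mulg1 => /esym/orb_classP[h Hh].
  by rewrite invg1 mulg1 => -[hgx _]; exists h.
by apply/etaGH_domP; exists (orb eta H (pact eta (h * g) x)); exact: muGH_phi.
Qed.

Fact etaGH_inv c z : etaGH_dom (c, z) ->
  etaGH_dom (c^-1, etaGH_act c z) /\ etaGH_act c^-1 (etaGH_act c z) = z.
Proof.
move=> cz; have e : phi z = muGH c^-1 (phi (etaGH_act c z)).
  by rewrite etaGH_actP// muGHM mulVg muGH1.
by split; [apply/etaGH_domP; exists z|exact: etaGH_eq].
Qed.

Fact etaGH_mul c d z : etaGH_dom (d, z) -> etaGH_dom (c, etaGH_act d z) ->
  etaGH_dom (c * d, z) /\ etaGH_act c (etaGH_act d z) = etaGH_act (c * d) z.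
Proof.
move=> dz cdz.
have e : phi (etaGH_act c (etaGH_act d z)) = muGH (c * d) (phi z).
  by rewrite etaGH_actP// etaGH_actP// muGHM.
by split; [apply/etaGH_domP; eexists; exact: e|exact/esym/etaGH_eq].
Qed.

Fact etaGH_one z : etaGH_dom (1, z) /\ etaGH_act 1 z = z.
Proof.
have e : phi z = muGH 1 (phi z) by rewrite muGH1.
by split; [apply/etaGH_domP; exists z|exact: etaGH_eq].
Qed.

Lemma etaGH_dom_open c : open [set z | etaGH_dom (c, z)].
Proof.
elim/cosetq_ind: c => g.
have -> : [set z | etaGH_dom (cosetq H g, z)] = orb eta H @`
    (\bigcup_(h in [set h | h \in H]) [set x | pdom eta (h * g, x)]).
  apply/seteqP; split=> [z|_ [x [h Hh hgx] <-]]; last first.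
    by apply/etaGH_domE; exists h.
  elim/orb_ind: z => x /etaGH_domE[h Hh hgx].
  by exists x => //; exists h.
by apply/orb_open/bigcup_open => h _; exact: pact_open.
Qed.

Lemma etaGH_act_continuous c :
  {within [set z | etaGH_dom (c, z)], continuous (etaGH_act c)}.
Proof.
rewrite continuous_open_subspace; last exact: etaGH_dom_open.
elim/cosetq_ind: c => g; elim/orb_ind => x; rewrite inE => /etaGH_domE[h Hh hgx].
have actE y : pdom eta (h * g, y) ->
    etaGH_act (cosetq H g) (orb eta H y) = orb eta H (pact eta (h * g) y).
  by move=> hgy; apply: etaGH_eq; exact: muGH_phi.
move=> W; rewrite /= actE// => /orb_continuous /(pact_continuous_at hgx) nW.
have nD : nbhs x [set y | pdom eta (h * g, y)].
  by apply: open_nbhs_nbhs; split=> //; exact: pact_open.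
apply: filterS (orb_nbhs eta H (filterI nD nW)).
by move=> _ [y [hgy Wy] <-] /=; rewrite actE.
Qed.

Fact etaGH_open c : open [set z | etaGH_dom (c^-1, z)].
Proof. exact: etaGH_dom_open. Qed.

Fact etaGH_homeo c : homeomorphism_between
  [set z | etaGH_dom ((c^-1)^-1, z)] [set z | etaGH_dom (c^-1, z)]
  (etaGH_act c).
Proof.
rewrite invgK; exists (etaGH_act c^-1); split.
- split=> z /= cz; first by have [] := etaGH_inv cz.
  by have [] := etaGH_inv cz; rewrite invgK.
- by move=> z /etaGH_inv[].
- by move=> z /etaGH_inv[_]; rewrite invgK.
- exact: etaGH_act_continuous.
- exact: etaGH_act_continuous.
Qed.

Definition etaGH : partial_action (quotg H) XH :=
  PartialAction etaGH_inv etaGH_mul etaGH_one etaGH_open etaGH_homeo.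

Lemma pset_etaGH c : pset etaGH c = etaGH_set c.
Proof. by rewrite /pset /= /etaGH_dom /= invgK. Qed.

End QuotientAction.

(* Main.v *)
Require Import Defs.
From mathcomp Require Import all_boot all_classical topology.

(** Write [phi] for the injection of [X/~H] into [X_G/~H].  The partial action
    [etaGH] is the restriction of the global action [muGH] along [phi]: it is
    defined at [(c, z)] exactly when [muGH c (phi z)] lies in the image of
    [phi], and then [phi] intertwines the two actions.  As
    [phi (orb x) = H[1, x]], the point [muGH (gH) (phi (orb x)) = H[g, x]] is
    in this image exactly when some [h * g], with [h] in [H], can be applied to
    [x]; this gives the description of the domain and of the values of [etaGH].

    For the globalization, consider [globGH], which sends [[c, z]] to
    [muGH c (phi z)].  As [muGH] is an action, the equality
    [muGH c (phi z) = muGH d (phi w)] amounts to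
    [phi w = muGH (d^-1 * c) (phi z)], which says that [(c, z)] and [(d, w)]
    are identified in the enveloping space ([envel_class_etaGHP]); so [globGH]
    is well defined and injective.  It maps
    [[gH, orb x]] to [H[g, x]], hence is onto, and it is equivariant because
    [muGH] is an action.  Both [globGH] and its inverse are continuous: the
    inverse because [X_G/~H] is an iterated quotient of [G * X], and [globGH]
    because the two projections [G -> G/H] and [X -> X/~H] are open, which
    makes their product [G * X -> G/H * X/~H] a quotient map. *)

Set Implicit Arguments.
Unset Strict Implicit.
Unset Printing Implicit Defensive.

Local Open Scope classical_set_scope.
Local Open Scope group_scope.
Local Open Scope quotient_scope.

Section Globalization.
Variables (G : topologicalGroupType) (X : topologicalType).
Variables (eta : partial_action G X) (H : normalSubgroup G).

Local Notation XH := (orbit_space eta H).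
Local Notation XGH := (orbit_space (envel_action eta) H).
Local Notation etaGH := (etaGH eta H).

Lemma envel_class_continuous :
  continuous (fun p : G * X => envel_class eta p.1 p.2).
Proof.
have -> : (fun p : G * X => envel_class eta p.1 p.2) = \pi_(envel eta).
  by apply/funext => -[].
exact: pi_continuous.
Qed.

Lemma orb_class_continuous :
  continuous (fun p : G * X => orb_class eta H p.1 p.2).
Proof.
move=> p; apply: (@continuous_comp _ _ _
  (fun p : G * X => envel_class eta p.1 p.2) (orb (envel_action eta) H)).
  exact: envel_class_continuous.
exact: orb_continuous.
Qed.

Lemma muGH_phiE g x :
  muGH (cosetq H g) (phi (orb eta H x)) = orb_class eta H g x.
Proof. by rewrite phiE muGHE mulg1. Qed.

(** Moving [muGH d] to the other side turns the equality on the left into the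
    condition that [d^-1 * c] is defined at [z] with value [w]. *)
Lemma envel_class_etaGHP (c d : quotg H) (z w : XH) :
  muGH c (phi z) = muGH d (phi w) <->
  envel_class etaGH c z = envel_class etaGH d w.
Proof.
split=> [e|/envel_classP[/= cz <-]].
  have {}e : phi w = muGH (d^-1 * c) (phi z).
    by rewrite -muGHM e muGHM mulVg muGH1.
  by apply/envel_classP; split; [apply/etaGH_domP; exists w|exact: etaGH_eq].
by rewrite etaGH_actP// muGHM mulVKg.
Qed.

Definition globGH (u : envel etaGH) : XGH := muGH (repr u).1 (phi (repr u).2).

Lemma globGHE c z : globGH (envel_class etaGH c z) = muGH c (phi z).
Proof.
apply/envel_class_etaGHP; rewrite /envel_class -surjective_pairing.
exact: reprK.
Qed.

Lemma globGH_class g x :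
  globGH (envel_class etaGH (cosetq H g) (orb eta H x)) = orb_class eta H g x.
Proof. by rewrite globGHE muGH_phiE. Qed.

Lemma globGH_inj : injective globGH.
Proof.
elim/envel_ind=> c z; elim/envel_ind=> d w; rewrite !globGHE.
by move/envel_class_etaGHP.
Qed.

(** The formula evaluates on chosen representatives; that the choice does not
    matter ([globGH_invE]) follows from the injectivity of [globGH]. *)
Definition globGH_inv (v : XGH) : envel etaGH :=
  envel_class etaGH (cosetq H (repr (repr v)).1)
    (orb eta H (repr (repr v)).2).

Lemma globGH_invK : cancel globGH_inv globGH.
Proof.
move=> v; rewrite globGH_class /orb_class /envel_class -surjective_pairing.
by rewrite reprK; exact: reprK.
Qed.

Lemma globGHK : cancel globGH globGH_inv.
Proof. exact: inj_can_sym globGH_invK globGH_inj. Qed.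

Lemma globGH_invE g x : globGH_inv (orb_class eta H g x) =
  envel_class etaGH (cosetq H g) (orb eta H x).
Proof. by rewrite -globGH_class globGHK. Qed.

(** A product of quotient maps need not be a quotient map, so the passage from
    [G * X] to [G/H * X/~H] relies on both projections being open. *)
Lemma muGH_phi_continuous :
  continuous (fun p : quotg H * XH => muGH p.1 (phi p.2)).
Proof.
move=> [c z]; elim/cosetq_ind: c => g; elim/orb_ind: z => x W /=.
rewrite muGH_phiE => /(@orb_class_continuous (g, x)) [[A B] /= [nA nB] AB].
exists (cosetq H @` A, orb eta H @` B).
  by split; [exact: cosetq_nbhs|exact: orb_nbhs].
move=> [_ _] /= [[a Aa <-] [b Bb <-]]; rewrite muGH_phiE.
exact: (AB (a, b)).
Qed.

Lemma globGH_continuous : continuous globGH.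
Proof.
apply/quotient_continuous.
have -> : globGH \o \pi_(envel etaGH) =
    (fun p : quotg H * XH => muGH p.1 (phi p.2)).
  by apply/funext => -[c z] /=; exact: globGHE.
exact: muGH_phi_continuous.
Qed.

Lemma globGH_inv_continuous : continuous globGH_inv.
Proof.
apply/quotient_continuous/quotient_continuous.
have -> : (globGH_inv \o \pi_XGH) \o \pi_(envel eta) =
    \pi_(envel etaGH) \o (fun p : G * X => (cosetq H p.1, orb eta H p.2)).
  by apply/funext => -[g x]; exact: globGH_invE.
move=> p; apply: continuous_comp; last exact: pi_continuous.
have cG : {for p, continuous (fun p : G * X => cosetq H p.1)}.
  apply: (@continuous_comp _ _ _ fst (cosetq H)); first exact: cvg_fst.
  exact: cosetq_continuous.
have cX : {for p, continuous (fun p : G * X => orb eta H p.2)}.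
  apply: (@continuous_comp _ _ _ snd (orb eta H)); first exact: cvg_snd.
  exact: orb_continuous.
exact: cvg_pair cG cX.
Qed.

Lemma globGH_equivalence :
  Kequivalent (envel_action etaGH) (muGH_action eta H).
Proof.
exists globGH; split; last first.
  exists globGH_inv; split; first exact: globGHK.
  - exact: globGH_invK.
  - exact: globGH_continuous.
  - exact: globGH_inv_continuous.
move=> k u _; split=> //=; elim/envel_ind: u => c z.
by rewrite envel_muE !globGHE muGHM.
Qed.

End Globalization.

Theorem theorem4p2 (G : topologicalGroupType) (X : topologicalType)
    (eta : partial_action G X) (H : normalSubgroup G) :
  hausdorff_space G ->
  [/\ (forall g : G,
        pset (etaGH eta H) (cosetq H g) =
        [set orb eta H x | x in
          [set x : X | exists2 h, h \in H & pdom eta (h * g^-1, x)]]),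
      pdom (etaGH eta H) =
        [set (cosetq H p.1, orb eta H p.2) | p in
          [set p : G * X | exists2 h, h \in H & pdom eta (h * p.1, p.2)]],
      (forall (g : G) (x : X),
        pdom (etaGH eta H) (cosetq H g, orb eta H x) ->
        forall h : G, h \in H -> pdom eta (h * g, x) ->
        pact (etaGH eta H) (cosetq H g) (orb eta H x) =
        orb eta H (pact eta (h * g) x))
    & Kequivalent (envel_action (etaGH eta H)) (muGH_action eta H)].
Proof.
move=> _; split.
- move=> g; rewrite /pset -cosetqV; apply/seteqP.
  split=> [z|_ [x hgx <-]]; last exact/etaGH_domE.
  by elim/orb_ind: z => x /etaGH_domE hgx; exists x.
- apply/seteqP; split=> [[c z]|_ [[g x] hgx <-]]; last exact/etaGH_domE.
  elim/cosetq_ind: c => g; elim/orb_ind: z => x /etaGH_domE hgx.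
  by exists (g, x).
- by move=> g x _ h Hh hgx; apply: etaGH_eq; exact: muGH_phi.
- exact: globGH_equivalence.
Qed.
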